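(* Let $\mathbf{t}$ be the Tribonacci sequence, fixed point of $0\mapsto01$, $1\mapsto02$, $2\mapsto0$. For each $k\ge1$, the smallest integer $C_k\ge1$ such that $\mathbf{t}$ is $(k,C_k)$-balanced is $C_k=2$.
   Context: For positive integers $k,C$, a sequence $\mathbf{x}$ over alphabet $A$ is $(k,C)$-balanced if for all factors $u,v$ of $\mathbf{x}$ with $|u|=|v|$ and every $w\in A^k$, $||u|_w-|v|_w|\le C$, where $|u|_w$ is the number of (possibly overlapping) occurrences of $w$ in $u$. *)

(* Defs.v *)
From mathcomp Require Import all_boot.
Set Implicit Arguments. Unset Strict Implicit. Unset Printing Implicit Defensive.

Definition in_alph (a : nat) : bool := a < 3.

Definition trib_img (a : nat) : seq nat :=
  match a with 0 => [:: 0; 1] | 1 => [:: 0; 2] | _ => [:: 0] end.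
Definition trib_morph (u : seq nat) : seq nat := flatten (map trib_img u).

(* sigma^m(0); it is a prefix of sigma^(m+1)(0) and has length >= m+1. *)
Definition trib_word (m : nat) : seq nat := iter m trib_morph [:: 0].

Definition trib (n : nat) : nat := nth 0 (trib_word n.+1) n.

Definition factor (x : nat -> nat) (i n : nat) : seq nat := mkseq (fun j => x (i + j)) n.

Definition occ (u w : seq nat) : nat :=
  count (fun j => take (size w) (drop j u) == w) (iota 0 (size u - size w).+1).

Definition balanced (x : nat -> nat) (k C : nat) : Prop :=
  forall (i j n : nat) (w : seq nat), size w = k -> all in_alph w ->
    (occ (factor x i n) w - occ (factor x j n) w <= C) /\
    (occ (factor x j n) w - occ (factor x i n) w <= C).

Example trib_prefix : [seq trib n | n <- iota 0 13] = [:: 0;1;0;2;0;1;0;0;1;0;2;0;1].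
Proof. by []. Qed.
Example occ_ex : occ [:: 0;1;0;1;0] [:: 0;1;0] = 2. Proof. by []. Qed.

(* Main.v *)
(** Let [s] be the morphism and [S m] the length of [s(t_0 .. t_(m-1))].
    Desubstituting shows that the occurrences of any factor of [t] form a set
    [{S^n(m) + c | m >= 0}], so consecutive occurrences are separated by the
    lengths of [s^n(t_0), s^n(t_1), ...], and balance amounts to comparing
    [|s^n(u)|] and [|s^n(v)|] for factors [u], [v] of [t] with [|u| = |v| + 1].
    For a pair of factors consider the differences [(d, a, b)] of their
    lengths, numbers of 0s and numbers of 1s.  Desubstitution expresses this
    vector as [(d' + a' + b' + c, d' + c, a')] with [|c| <= 2], from the vector
    of a pair of shorter factors; hence all those with [|d| <= 6] lie in a fixed
    polytope, and [d = 1] then forces [|s^n(u)| >= |s^n(v)|] for all [n].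
    For the lower bound, a prefix of length [k >= 2] of [t] has two occurrences
    at distance [|s^n(2)|] and two consecutive ones at distance [|s^n(0)|], which is
    larger by at least 2. *)
From Stdlib Require Import ZArith Lia.
Require Import Defs.
From mathcomp Require Import all_boot zify.


(** * The infinite sequence as the limit of the words [trib_word m] *)

Lemma trib_morph_cat u v : trib_morph (u ++ v) = trib_morph u ++ trib_morph v.
Proof. by rewrite /trib_morph map_cat flatten_cat. Qed.

Lemma prefix_trib_morph u v : prefix u v -> prefix (trib_morph u) (trib_morph v).
Proof. by case/prefixP=> s ->; rewrite trib_morph_cat prefix_prefix. Qed.

Lemma trib_wordS m : trib_word m.+1 = trib_morph (trib_word m).
Proof. by []. Qed.

Lemma trib_word_prefix m n : m <= n -> prefix (trib_word m) (trib_word n).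
Proof.
elim: n => [|n IHn]; first by rewrite leqn0 => /eqP ->.
rewrite leq_eqVlt => /predU1P[->|/IHn mn]; first exact: prefix_refl.
apply: prefix_trans mn _.
by elim: n {IHn} => // n; apply: prefix_trib_morph.
Qed.

Lemma size_trib_morph (u : seq nat) : size u + (0 \in u) <= size (trib_morph u).
Proof.
elim: u => // a u IHu; rewrite in_cons -cat1s trib_morph_cat !size_cat.
by case: a => [|[|a]]; rewrite /= ?cats0 /=; move: (0 \in u) IHu => [] /=; lia.
Qed.

Lemma size_trib_word m : m < size (trib_word m).
Proof.
elim: m => // m IHm; rewrite trib_wordS; apply: leq_trans (size_trib_morph _).
suff -> : 0 \in trib_word m by rewrite addn1.
have /prefixP[s ->] : prefix [:: 0] (trib_word m) by apply: (trib_word_prefix 0).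
exact: mem_head.
Qed.

Lemma nth_trib_word m n : n < size (trib_word m) -> nth 0 (trib_word m) n = trib n.
Proof.
move=> n_lt; rewrite /trib; have n_lt' := ltn_trans (ltnSn n) (size_trib_word n.+1).
case: (leqP m n.+1) => [|/ltnW] /trib_word_prefix/prefixP[s ->];
  by rewrite nth_cat ?n_lt ?n_lt'.
Qed.

Lemma mkseq_trib u m : prefix u (trib_word m) -> mkseq trib (size u) = u.
Proof.
move=> um; apply: (@eq_from_nth _ 0) => [|n]; rewrite size_mkseq // => n_lt.
rewrite nth_mkseq //; case/prefixP: um n_lt => s def_m n_lt.
by rewrite -(nth_trib_word m) def_m ?nth_cat ?n_lt // size_cat ltn_addr.
Qed.

Lemma prefix_mkseq_trib n : prefix (mkseq trib n) (trib_word n).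
Proof.
rewrite prefixE size_mkseq; apply/eqP/(@eq_from_nth _ 0) => [|i].
  by rewrite size_mkseq size_takel // ltnW ?size_trib_word.
rewrite size_takel ?(ltnW (size_trib_word _)) // => i_lt.
by rewrite nth_take // nth_mkseq // nth_trib_word // (ltn_trans i_lt) ?size_trib_word.
Qed.

(** * Desubstitution of positions and letter counts *)

(* Position where the image of the [n]-th letter starts. *)
Definition sigma_pos (n : nat) : nat := size (trib_morph (mkseq trib n)).

Lemma mkseq_trib_sigma_pos n :
  mkseq trib (sigma_pos n) = trib_morph (mkseq trib n).
Proof.
exact: (mkseq_trib _ n.+1 (prefix_trib_morph _ _ (prefix_mkseq_trib n))).
Qed.

Lemma trib_lt3 n : trib n < 3.
Proof.
have trib3 m : all in_alph (trib_word m).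
  elim: m => // m; rewrite trib_wordS.
  by elim: (trib_word m) => //= -[|[|a]] u IHu /andP[_ /IHu].
by apply: (allP (trib3 n.+1)); rewrite mem_nth // (ltn_trans (ltnSn n)) ?size_trib_word.
Qed.

Lemma sigma_pos0 : sigma_pos 0 = 0.
Proof. by []. Qed.

Lemma sigma_posS n : sigma_pos n.+1 = sigma_pos n + (trib n != 2).+1.
Proof.
rewrite /sigma_pos mkseqS -cats1 trib_morph_cat size_cat; congr (_ + _).
by case: (trib n) (trib_lt3 n) => [|[|[|a]]].
Qed.

Lemma nth_trib_img n o : o < (trib n != 2).+1 ->
  trib (sigma_pos n + o) = nth 0 (trib_img (trib n)) o.
Proof.
move=> o_lt; have <- : nth 0 (mkseq trib (sigma_pos n.+1)) (sigma_pos n + o) =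
    trib (sigma_pos n + o) by rewrite nth_mkseq // sigma_posS; lia.
rewrite mkseq_trib_sigma_pos mkseqS -cats1 trib_morph_cat nth_cat.
rewrite ifN -?leqNgt ?leq_addr // addKn.
by rewrite /trib_morph /= cats0.
Qed.

Lemma trib_sigma_pos n : trib (sigma_pos n) = 0.
Proof.
by have := nth_trib_img n 0 isT; rewrite addn0 => ->; case: (trib n) => [|[|a]].
Qed.

(** The letter 2 obeys the formula too: its image is a single 0, so the next position starts a new
    image with 0, which is 3 mod 3. *)
Lemma trib_sigma_pos1 n : trib (sigma_pos n).+1 = (trib n).+1 %% 3.
Proof.
case: (eqVneq (trib n) 2) => [t2|tN2].
  by have := sigma_posS n; rewrite t2 addn1 => <-; rewrite trib_sigma_pos.
rewrite -addn1 nth_trib_img ?tN2 //.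
by case: (trib n) (trib_lt3 n) tN2 => [|[|[|a]]].
Qed.

Lemma sigma_pos_ltS n : sigma_pos n < sigma_pos n.+1.
Proof. by rewrite sigma_posS addnS ltnS leq_addr. Qed.

Lemma sigma_pos_decomp p :
  exists n o, p = sigma_pos n + o /\ o < (trib n != 2).+1.
Proof.
elim: p => [|p [n [o [-> o_lt]]]]; first by exists 0, 0.
have [o_lt'|o_ge] := ltnP o.+1 (trib n != 2).+1.
  by exists n, o.+1; rewrite addnS.
by exists n.+1, 0; rewrite sigma_posS; split; lia.
Qed.

Definition trib_count (a n : nat) : nat := count_mem a (mkseq trib n).

Lemma trib_countS a n : trib_count a n.+1 = trib_count a n + (trib n == a).
Proof. by rewrite /trib_count mkseqS -cats1 count_cat /= addn0. Qed.

Lemma sigma_pos_count n : sigma_pos n = n + trib_count 0 n + trib_count 1 n.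
Proof.
elim: n => // n IHn; rewrite sigma_posS !trib_countS IHn.
by case: (trib n) (trib_lt3 n) => [|[|[|a]]] //= _; lia.
Qed.

(** Each image contains a single 0, as its first letter, and the letter 1 occurs only in the image
    of 0. *)
Lemma trib_count_sigma_pos n o : o < (trib n != 2).+1 ->
  trib_count 0 (sigma_pos n + o) = n + o /\
  trib_count 1 (sigma_pos n + o) = trib_count 0 n.
Proof.
have count0 : trib_count 0 (sigma_pos n) = n /\
              trib_count 1 (sigma_pos n) = trib_count 0 n.
  elim: n => // n [IH0 IH1]; rewrite trib_countS sigma_posS.
  rewrite addnS trib_countS trib_countS.
  case: (eqVneq (trib n) 2) => [t2|tN2]; rewrite ?addn0 ?addn1 ?trib_countS trib_sigma_pos.
    by rewrite t2 IH0 IH1; lia.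
  rewrite trib_sigma_pos1 IH0 IH1.
  by case: (trib n) (trib_lt3 n) tN2 => [|[|[|a]]] //= _ _; lia.
case: o => [|[|o]]; rewrite ?addn0 ?addn1 //; last by lia.
by rewrite !trib_countS trib_sigma_pos count0.1 count0.2 /=; lia.
Qed.

Lemma leq_sigma_pos m n : m <= n -> sigma_pos m + (n - m) <= sigma_pos n.
Proof.
move=> /subnKC <-; elim: (n - m) => [|d IHd]; first by rewrite addn0 subnn addn0.
by have := sigma_pos_ltS (m + d); rewrite !addnS; lia.
Qed.

Lemma sigma_pos_ge n : n + (0 < n) <= sigma_pos n.
Proof.
case: n => // n; have := leq_sigma_pos 1 n.+1 isT.
by rewrite (_ : sigma_pos 1 = 2) //; lia.
Qed.

Lemma leq_sigma_pos_decomp m n o o' :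
  o < (trib m != 2).+1 -> o' < (trib n != 2).+1 ->
  sigma_pos m + o <= sigma_pos n + o' -> m <= n.
Proof.
move=> o_lt o'_lt le_mn; case: (leqP m n) => // lt_nm.
by have := leq_sigma_pos _ _ lt_nm; rewrite sigma_posS; lia.
Qed.

(** * The polytope of difference vectors *)

(** The windows are [[i, j)] and [[k, l)], and [f] is a cumulative count: [id] and the two
    [trib_count] functions give [d], [a] and [b]. *)
Definition factor_diff (f : nat -> nat) (i j k l : nat) : Z :=
  (Z.of_nat (f j) - Z.of_nat (f i) - (Z.of_nat (f l) - Z.of_nat (f k)))%Z.

(* The facets were found from the finite set of vectors reachable from 0 under
   the map of [in_polytope_step] with [|d| <= 6]; 6 is the least bound for which
   [in_polytope_expands] holds. *)
Definition in_polytope (d a b : Z) : Prop :=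
  (-9 <= 3 * d - 4 * a - 2 * b <= 9 /\ -6 <= 2 * d - 2 * a - 3 * b <= 6 /\
   -22 <= d - 5 * a + 6 * b <= 22 /\ -15 <= 4 * d - 7 * a - b <= 15)%Z.

Lemma in_polytope_step d a b c : (-6 <= d <= 6)%Z -> (-2 <= c <= 2)%Z ->
  in_polytope d a b -> (-6 <= d + a + b + c <= 6)%Z ->
  in_polytope (d + a + b + c) (d + c) a.
Proof. by rewrite /in_polytope; lia. Qed.

Lemma in_polytope_expands a b c : (-2 <= c <= 2)%Z ->
  in_polytope 6 a b -> (6 < 6 + a + b + c)%Z.
Proof. by rewrite /in_polytope; lia. Qed.

Lemma factor_diff_swap f i j k l : factor_diff f k l i j = (- factor_diff f i j k l)%Z.
Proof. by rewrite /factor_diff; lia. Qed.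

Lemma factor_diff_sigma_pos i j k l :
  factor_diff sigma_pos i j k l =
  (factor_diff id i j k l + factor_diff (trib_count 0) i j k l +
   factor_diff (trib_count 1) i j k l)%Z.
Proof. by rewrite /factor_diff !sigma_pos_count; lia. Qed.

(** Strong induction on the sum of the endpoints, which desubstitution lowers. If the shorter pair
    has length difference beyond 6 in absolute value, then so does the original pair; this is the
    purpose of [trim]. *)
Lemma in_polytope_factor_diff i j k l : i <= j -> k <= l ->
  (-6 <= factor_diff id i j k l <= 6)%Z ->
  in_polytope (factor_diff id i j k l) (factor_diff (trib_count 0) i j k l)
              (factor_diff (trib_count 1) i j k l).
Proof.
have [s] := ubnP (i + j + k + l); elim: s i j k l => // s IHs i j k l le_s le_ij le_kl.
case: (posnP (i + j + k + l)) => [/eqP|sum_gt0].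
  by rewrite !addn_eq0 => /andP[/andP[/andP[/eqP-> /eqP->] /eqP->] /eqP->].
have [i' [oi [def_i oi_lt]]] := sigma_pos_decomp i.
have [j' [oj [def_j oj_lt]]] := sigma_pos_decomp j.
have [k' [ok [def_k ok_lt]]] := sigma_pos_decomp k.
have [l' [ol [def_l ol_lt]]] := sigma_pos_decomp l.
have le_ij' : i' <= j' by apply: leq_sigma_pos_decomp oi_lt oj_lt _; rewrite -def_i -def_j.
have le_kl' : k' <= l' by apply: leq_sigma_pos_decomp ok_lt ol_lt _; rewrite -def_k -def_l.
have lt_s : i' + j' + k' + l' < s.
  have [gi gj gk gl] := And4 (sigma_pos_ge i') (sigma_pos_ge j') (sigma_pos_ge k') (sigma_pos_ge l').
  clear -gi gj gk gl le_s sum_gt0 def_i def_j def_k def_l; lia.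
pose c := (Z.of_nat oj - Z.of_nat oi - (Z.of_nat ol - Z.of_nat ok))%Z.
have c_le : (-2 <= c <= 2)%Z by rewrite /c; clear -oi_lt oj_lt ok_lt ol_lt; lia.
have [d_eq a_eq b_eq] : [/\
    factor_diff id i j k l = (factor_diff sigma_pos i' j' k' l' + c)%Z,
    factor_diff (trib_count 0) i j k l = (factor_diff id i' j' k' l' + c)%Z &
    factor_diff (trib_count 1) i j k l = factor_diff (trib_count 0) i' j' k' l'].
  have [i0 i1] := trib_count_sigma_pos i' _ oi_lt.
  have [j0 j1] := trib_count_sigma_pos j' _ oj_lt.
  have [k0 k1] := trib_count_sigma_pos k' _ ok_lt.
  have [l0 l1] := trib_count_sigma_pos l' _ ol_lt.
  rewrite /factor_diff def_i def_j def_k def_l i0 i1 j0 j1 k0 k1 l0 l1 /c.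
  by clear; split; lia.
rewrite d_eq a_eq b_eq => d_le.
(* A first factor that is too long is cut down to length difference 6, where
   [in_polytope_expands] already gives too long an image. *)
have trim x y z t : x <= y -> z <= t -> x + y + z + t < s ->
    (6 < factor_diff id x y z t)%Z ->
    forall c, (-2 <= c <= 2)%Z -> (6 < factor_diff sigma_pos x y z t + c)%Z.
  move=> le_xy le_zt lt_xyzt d_gt c' c'_le; pose e := x + 6 + (t - z).
  have [le_xe le_ey d_e] : [/\ x <= e, e <= y & factor_diff id x e z t = 6%Z].
    by move: d_gt; rewrite /factor_diff /e; clear -le_xy le_zt; split; lia.
  have e_s : x + e + z + t < s by clear -lt_xyzt le_ey; lia.
  have := IHs x e z t e_s le_xe le_zt; rewrite d_e => /(_ ltac:(done)).
  move=> /(in_polytope_expands _ _ _ c'_le).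
  have := factor_diff_sigma_pos x e z t; have := leq_sigma_pos _ _ le_ey.
  rewrite d_e /factor_diff; clear; lia.
have [d'_gt|d'_le] := Z_lt_le_dec 6 (factor_diff id i' j' k' l').
  have := trim _ _ _ _ le_ij' le_kl' lt_s d'_gt _ c_le; clear -d_le; lia.
have [d'_lt|d'_ge] := Z_lt_le_dec (factor_diff id i' j' k' l') (-6).
  have lt_s' : k' + l' + i' + j' < s by clear -lt_s; lia.
  have := trim _ _ _ _ le_kl' le_ij' lt_s'; rewrite !(factor_diff_swap _ i').
  move=> /(_ ltac:(lia) (- c)%Z ltac:(lia)); clear -d_le; lia.
move: d_le; rewrite factor_diff_sigma_pos => d_le.
by apply: in_polytope_step => //; apply: IHs.
Qed.

(** * Lengths of iterated images *)

(** The prefix of length [sigma_pos p] contains [p] zeros, and its image contains [p] ones. *)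
Lemma iter_sigma_pos_rec n m :
  iter n.+3 sigma_pos m =
  iter n.+2 sigma_pos m + iter n.+1 sigma_pos m + iter n sigma_pos m.
Proof.
have c m' := trib_count_sigma_pos m' 0 isT.
rewrite !iterS; set p := iter n sigma_pos m.
have [c1 _] := c p; have [c2 c3] := c (sigma_pos p).
by rewrite [LHS]sigma_pos_count; move: c1 c2 c3; rewrite !addn0 => c1 -> ->; rewrite c1.
Qed.

(** The differences [x n] obey the Tribonacci recurrence, so it suffices that the first three are
    nonnegative. These are 1, [1 + a + b] and [2 + 2 * a + b], bounded below by the polytope at
    [d = 1]. *)
Lemma iter_sigma_pos_balance n i j k l : i <= j -> k <= l -> j + k = (i + l).+1 ->
  iter n sigma_pos l + iter n sigma_pos i <= iter n sigma_pos j + iter n sigma_pos k.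
Proof.
move=> le_ij le_kl eq_len; pose x n := factor_diff (iter n sigma_pos) i j k l.
have x0 : x 0 = 1%Z by rewrite /x /factor_diff /=; lia.
have xS n' : x n'.+3 = (x n'.+2 + x n'.+1 + x n')%Z.
  by rewrite /x /factor_diff !iter_sigma_pos_rec; lia.
(* The second coordinate is [a], solved from [x 1 = 1 + a + b]. *)
have xP : in_polytope (x 0) (x 1 - x 0 - factor_diff (trib_count 1) i j k l)
    (factor_diff (trib_count 1) i j k l).
  have d1 : factor_diff id i j k l = 1%Z := x0.
  have x1 : x 1 = _ := factor_diff_sigma_pos i j k l.
  have := in_polytope_factor_diff i j k l le_ij le_kl; rewrite d1 => /(_ ltac:(done)).
  by rewrite x0 x1 d1; congr in_polytope; lia.
have x2 : x 2 = (x 1%N + (x 1%N - factor_diff (trib_count 1) i j k l))%Z.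
  rewrite /x /factor_diff /= !(sigma_pos_count (sigma_pos _)).
  have c m : trib_count 0 (sigma_pos m) = m /\ trib_count 1 (sigma_pos m) = trib_count 0 m.
    by have := trib_count_sigma_pos m 0 isT; rewrite !addn0.
  rewrite !(proj1 (c _)) !(proj2 (c _)).
  have := sigma_pos_count i; have := sigma_pos_count j.
  by have := sigma_pos_count k; have := sigma_pos_count l; lia.
have [x1_ge x2_ge] : (0 <= x 1%N /\ 0 <= x 2%N)%Z.
  by move: xP; rewrite x2 x0 /in_polytope; lia.
have x_ge n' : [/\ 0 <= x n', 0 <= x n'.+1 & 0 <= x n'.+2]%Z.
  by elim: n' => [|n' [? ? ?]]; split=> //; rewrite ?x0 // xS; lia.
by have [] := x_ge n; rewrite /x /factor_diff; lia.
Qed.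

Lemma leq_iter_sigma_pos n m m' :
  m <= m' -> iter n sigma_pos m + (m' - m) <= iter n sigma_pos m'.
Proof.
move=> le_mm'; elim: n => [|n IHn] /=; first by rewrite subnKC.
by have := leq_sigma_pos (iter n sigma_pos m) (iter n sigma_pos m'); lia.
Qed.

Lemma iter_sigma_pos_gt n : n < iter n sigma_pos 1.
Proof. by elim: n => //= n IHn; have := sigma_pos_ge (iter n sigma_pos 1); lia. Qed.

(** * The set of occurrences of a factor *)

Definition agree (p q k : nat) : Prop := forall j, j < k -> trib (p + j) = trib (q + j).

Lemma agree_sigma_pos_add p q k : agree p q k ->
  sigma_pos (p + k) + sigma_pos q = sigma_pos (q + k) + sigma_pos p.
Proof.
elim: k => [|k IHk] pq; first by rewrite !addn0 addnC.
have := IHk (fun j lt_jk => pq j (ltnW lt_jk)).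
by rewrite !addnS !sigma_posS (pq k (ltnSn k)); lia.
Qed.

(** Every image starts with 0, so one letter beyond the common image still agrees; hence [e]. *)
Lemma agree_sigma_pos p q k e : agree p q k -> e <= 1 ->
  agree (sigma_pos p) (sigma_pos q) (sigma_pos (q + k) + e - sigma_pos q).
Proof.
move=> pq e_le j lt_j.
have [r [o [def_r o_lt]]] := sigma_pos_decomp (sigma_pos q + j).
have le_qr : q <= r by apply: (@leq_sigma_pos_decomp q r 0 o) => //; rewrite -def_r addn0 leq_addr.
have le_rk : r <= q + k.
  case: leqP => // /leq_sigma_pos; rewrite sigma_posS.
  by move: (trib _ != 2); lia.
have r_eq : sigma_pos (p + (r - q)) + sigma_pos q = sigma_pos r + sigma_pos p.
  have := agree_sigma_pos_add p q (r - q); rewrite subnKC //; apply=> i lt_i.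
  by apply: pq; lia.
rewrite def_r (_ : sigma_pos p + j = sigma_pos (p + (r - q)) + o); last by lia.
case: o o_lt def_r => [|[|o]]; rewrite ?addn0 ?trib_sigma_pos ?addn1 //; last by lia.
move=> _ def_r; rewrite !trib_sigma_pos1 pq ?subnKC //.
case: (ltnP r (q + k)) => [|le_kr]; first by lia.
by move: def_r; rewrite (_ : r = q + k); lia.
Qed.

Lemma agree_sigma_pos_prefix p s : agree p 0 s ->
  sigma_pos (p + s) = sigma_pos p + sigma_pos s /\ agree (sigma_pos p) 0 (sigma_pos s).
Proof.
move=> ps; have := agree_sigma_pos_add _ _ _ ps; have := agree_sigma_pos _ _ _ 0 ps isT.
by rewrite sigma_pos0 !addn0 subn0 add0n => ? ->; rewrite addnC.
Qed.

Lemma agree_iter_sigma_pos n : agree (iter n sigma_pos 2) 0 (iter n sigma_pos 1).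
Proof.
elim: n => [|n IHn]; first by case.
by have [] := agree_sigma_pos_prefix _ _ IHn.
Qed.

Lemma trib_eq0 p : trib p = 0 -> exists m, p = sigma_pos m.
Proof.
have [m [[|[|o]] [-> o_lt]]] := sigma_pos_decomp p; try by [exists m; rewrite addn0 | lia].
rewrite addn1 trib_sigma_pos1; move: o_lt.
by case: (trib m) (trib_lt3 m) => [|[|[|a]]].
Qed.

(** A 0 marks the start of an image, and the letter after it determines the source letter. The bound
    on [q + k'] drives the later induction on the end of the window. *)
Lemma agree_desubst q k : 0 < k ->
  exists2 k', q + k' < sigma_pos q + k &
  forall p, agree p (sigma_pos q) k <-> exists2 m, p = sigma_pos m & agree m q k'.
Proof.
move=> k_gt0; have [r [o [def_r o_lt]]] := sigma_pos_decomp (sigma_pos q + k.-1).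
have le_qr : q <= r by apply: (@leq_sigma_pos_decomp q r 0 o) => //; rewrite -def_r addn0 leq_addr.
(* A final 0 does not reveal which image it starts, so it is split off as [e = 1]. *)
have [k' [e [e_le def_e def_k]]] : exists k' e, [/\ e <= 1,
    sigma_pos q + k = sigma_pos (q + k') + e &
    forall j, j < k' -> (sigma_pos (q + j)).+1 < sigma_pos q + k].
  case: o o_lt def_r => [|[|o]] o_lt def_r; last by move: o_lt; case: (_ != _).
    exists (r - q), 1; rewrite subnKC //; split=> // [|j lt_j]; first by lia.
    have /leq_sigma_pos: q + j < r by lia.
    by have := sigma_pos_ltS (q + j); lia.
  exists (r - q).+1, 0; rewrite addnS subnKC // sigma_posS; split=> // [|j lt_j].
    by move: o_lt; case: (_ != _) => //; lia.
  have /leq_sigma_pos: q + j <= r by lia.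
  by lia.
exists k' => [|p].
  have := sigma_pos_ge (q + k'); rewrite def_e.
  case: posnP => [qk'0|]; last by lia.
  by move: def_e; rewrite qk'0 sigma_pos0 (_ : q = 0) ?sigma_pos0; lia.
split=> [pq|[m -> mq]]; last first.
  by have := agree_sigma_pos _ _ _ e mq e_le; rewrite -def_e addKn.
have [m def_p] : exists m, p = sigma_pos m.
  by apply: trib_eq0; have := pq 0 k_gt0; rewrite !addn0 trib_sigma_pos.
(* The next image can be located only once the previous letters agree, so letters are recovered one
   at a time. *)
exists m => //; suff mq j : j <= k' -> agree m q j by apply: mq.
elim: j => // j IHj lt_jk i; rewrite ltnS leq_eqVlt => /predU1P[->|]; last exact: IHj (ltnW lt_jk) _.
have mq_eq := agree_sigma_pos_add _ _ _ (IHj (ltnW lt_jk)).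
have lt_k := def_k j lt_jk; have le_q := leq_sigma_pos _ _ (leq_addr j q).
have := pq ((sigma_pos (q + j)).+1 - sigma_pos q); rewrite def_p.
rewrite (_ : sigma_pos m + _ = (sigma_pos (m + j)).+1); last by lia.
rewrite subnKC ?trib_sigma_pos1; last by lia.
move=> /(_ ltac:(lia)).
by case: (trib (m + j)) (trib_lt3 (m + j)) (trib (q + j)) (trib_lt3 (q + j)) =>
  [|[|[|a]]] // _ [|[|[|b]]].
Qed.

(** The first conjunct makes [sigma_pos] additive at the offset [s], so that the description
    survives another application of the morphism. *)
Lemma agree_occurrences q k : exists n s,
  (forall m, agree (iter n sigma_pos m) 0 s) /\
  (forall p, agree p q k <-> exists m, p = iter n sigma_pos m + s).
Proof.
have [b] := ubnP (q + k); elim: b q k => // b IHb q k lt_b.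
case: (posnP k) => [->|k_gt0].
  by exists 0, 0; split=> // p; split=> // _; exists p; rewrite addn0.
have step q' K : 0 < K -> sigma_pos q' + K = q + k -> exists n s,
    (forall m, agree (iter n sigma_pos m) 0 s) /\
    (forall p, agree p (sigma_pos q') K <-> exists m, p = iter n sigma_pos m + s).
  move=> K_gt0 eqK; have [k' lt_k' occ_q] := agree_desubst q' K K_gt0.
  have [|n [s [pref_s occ_s]]] := IHb q' k'; first by lia.
  exists n.+1, (sigma_pos s); split=> [m|p].
    by have [] := agree_sigma_pos_prefix _ _ (pref_s m).
  rewrite occ_q; split=> [[m -> /occ_s[m' ->]]|[m ->]].
    by exists m'; have [-> _] := agree_sigma_pos_prefix _ _ (pref_s m').
  exists (iter n sigma_pos m + s); last by apply/occ_s; exists m.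
  by have [-> _] := agree_sigma_pos_prefix _ _ (pref_s m).
have [q' [[|[|o]] [def_q o_lt]]] := sigma_pos_decomp q; last by lia.
  by rewrite def_q addn0; apply: step; lia.
(* A window starting on the second letter of an image starts with a nonzero letter, so each
   occurrence extends to the left by a 0. *)
have [|n [s [pref_s occ_s]]] := step q' k.+1 isT; first by lia.
exists n, s.+1; split=> [m j|p].
  rewrite ltnS leq_eqVlt => /predU1P[->|]; last exact: pref_s.
  have occ0 m' : trib (iter n sigma_pos m' + s) = 0.
    have /occ_s/(_ 0 isT) : exists m, iter n sigma_pos m' + s = iter n sigma_pos m + s.
      by exists m'.
    by rewrite !addn0 trib_sigma_pos.
  have iter0 : iter n sigma_pos 0 = 0 by elim: (n) => //= n' ->.
  by rewrite occ0; have := occ0 0; rewrite iter0 => ->.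
rewrite def_q; split=> [pq|[m ->] j lt_j].
  have [p' def_p] : exists p', p = (sigma_pos p').+1.
    have := pq 0 k_gt0; rewrite !addn0 addn1 trib_sigma_pos1.
    have [p' [[|[|o]] [-> o'_lt]]] := sigma_pos_decomp p; last by lia.
      rewrite addn0 trib_sigma_pos; move: o_lt.
      by case: (trib q') (trib_lt3 q') => [|[|[|a]]].
    by exists p'; rewrite addn1.
  have [|m m_eq] := (occ_s (sigma_pos p')).1; last by exists m; rewrite def_p m_eq addnS.
  move=> [|j] lt_j; first by rewrite !addn0 !trib_sigma_pos.
  by have := pq j lt_j; rewrite def_p addn1 !addSnnS.
have /occ_s/(_ j.+1 lt_j) : exists m', iter n sigma_pos m + s = iter n sigma_pos m' + s.
  by exists m.
by rewrite addn1 !addnS !addSn.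
Qed.

(** * Counting occurrences in a window *)

Lemma take_drop_factor x i n j k : j + k <= n ->
  take k (drop j (factor x i n)) = factor x (i + j) k.
Proof.
move=> le_n; have sz : size (take k (drop j (factor x i n))) = k.
  by rewrite size_takel // size_drop size_mkseq; lia.
apply: (@eq_from_nth _ 0); rewrite sz ?size_mkseq // => r lt_r.
by rewrite nth_take // nth_drop !nth_mkseq ?addnA //; lia.
Qed.

Lemma occ_factor x i n w : size w <= n ->
  occ (factor x i n) w =
  count (fun p => factor x p (size w) == w) (iota i (n - size w).+1).
Proof.
move=> le_wn; rewrite /occ size_mkseq -{2}[i]addn0 iotaDl count_map.
apply: eq_in_count => j; rewrite mem_iota => /andP[_ lt_j] /=.
by rewrite take_drop_factor //; lia.
Qed.

Lemma occ_short u w : size u < size w -> occ u w = 0.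
Proof.
move=> lt_uw; rewrite /occ (_ : size u - size w = 0); last by lia.
rewrite /= drop0 take_oversize ?(ltnW lt_uw) //.
by case: eqP => // eq_uw; rewrite eq_uw ltnn in lt_uw.
Qed.

Lemma eq_factor_agree p q k : reflect (agree p q k) (factor trib p k == factor trib q k).
Proof.
apply: (iffP eqP) => [eq_pq j lt_j|pq].
  by have := congr1 (nth 0 ^~ j) eq_pq; rewrite !nth_mkseq.
by apply: (@eq_from_nth _ 0); rewrite !size_mkseq // => j lt_j; rewrite !nth_mkseq // pq.
Qed.

(** Turns counts into positions, so that windows can be compared through the values of [G]. *)
Lemma count_iota_increasing (Q : pred nat) (G : nat -> nat) :
  {mono G : m n / m < n} -> (forall p, Q p <-> exists m, p = G m) ->
  forall i m, (G m < i) = (m < count Q (iota 0 i)).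
Proof.
move=> G_mono QP; elim=> [|i IHi] m //.
have -> : count Q (iota 0 i.+1) = count Q (iota 0 i) + Q i.
  by rewrite -addn1 iotaD count_cat /= addn0.
rewrite ltnS leq_eqVlt IHi; case Qi: (Q i); last first.
  rewrite addn0; case: eqP => // Gm; suff: Q i by rewrite Qi.
  by apply/QP; exists m.
have [m0 def_i] := (QP i).1 Qi.
have -> : count Q (iota 0 i) = m0.
  apply/eqP; rewrite eqn_leq leqNgt -IHi -def_i ltnn /=.
  by rewrite leqNgt -G_mono -def_i IHi ltnn.
have G_inj : injective G by move=> a b eqG; have := G_mono a b; have := G_mono b a; rewrite eqG ltnn; lia.
by rewrite def_i (inj_eq G_inj) addn1 ltnS [RHS]leq_eqVlt.
Qed.

Lemma count_iota_sub (Q : pred nat) i len :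
  count Q (iota 0 i) + count Q (iota i len) = count Q (iota 0 (i + len)).
Proof. by rewrite iotaD count_cat. Qed.

Lemma iter_sigma_pos_mono n s : {mono (fun m => iter n sigma_pos m + s) : m m' / m < m'}.
Proof.
move=> m m'; apply/idP/idP => [|/leq_iter_sigma_pos]; last first.
  by move=> /(_ n); have := @leq_iter_sigma_pos n m m.+1 (leqnSn m); lia.
by apply: contraLR; rewrite -!leqNgt => /(leq_iter_sigma_pos n); lia.
Qed.

Lemma factor_shift i n p : agree p 0 (i + n) -> factor trib (p + i) n = factor trib i n.
Proof.
move=> p0; apply/eqP/eq_factor_agree => j lt_j.
by rewrite -addnA p0 ?add0n // ltn_add2l.
Qed.

(** * The upper and lower bounds *)

Lemma occ_factor_trib_le2 i j n w :
  0 < size w -> occ (factor trib i n) w - occ (factor trib j n) w <= 2.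
Proof.
move=> w_gt0; set k := size w.
have [lt_n|le_n] := ltnP n k; first by rewrite (@occ_short (factor trib i n)) ?size_mkseq.
case: (posnP (occ (factor trib i n) w)) => [->|//]; rewrite occ_factor // -has_count.
case/hasP=> q _ /eqP def_w.
have [N [s [_ occ_q]]] := agree_occurrences q k.
(* Moving the second window to the right, to another occurrence of the same
   factor, ensures that some occurrence of [w] starts before it. *)
pose P := iter (j + n + s) sigma_pos 2.
have agreeP : agree P 0 (j + n).
  move=> r lt_r; apply: agree_iter_sigma_pos.
  by have := iter_sigma_pos_gt (j + n + s); lia.
have P_gt : s < P.
  have := iter_sigma_pos_gt (j + n + s).
  by have := @leq_iter_sigma_pos (j + n + s) 1 2 isT; rewrite /P; lia.
rewrite -(factor_shift _ _ _ agreeP) !occ_factor //.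
set Q : pred nat := fun p => _; set len := (n - size w).+1.
pose G m := iter N sigma_pos m + s.
have QP p : Q p <-> exists m, p = G m.
  rewrite -occ_q; split; first by rewrite /Q -/k -def_w => /eq_factor_agree.
  by move/eq_factor_agree; rewrite /Q -/k def_w.
have lo := count_iota_increasing Q G (iter_sigma_pos_mono N s) QP.
have := count_iota_sub Q i len; have := count_iota_sub Q (P + j) len.
set a := count Q (iota 0 i); set b := count Q (iota 0 (P + j)).
set A := count Q (iota i len); set B := count Q (iota (P + j) len).
(* If [A >= B + 3], the occurrences numbered [a] and [a + B + 2] are less than [len] apart, while
   those numbered [b - 1] and [b + B] enclose the second window and are more than [len] apart. This
   contradicts the balance between [B + 2] and [B + 1] iterated images. *)
move=> eqB eqA; rewrite leqNgt; apply/negP => gt_AB.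
have iter0 : iter N sigma_pos 0 = 0 by elim: (N) => //= n' ->.
have b_gt0 : 0 < b by rewrite -lo /G iter0; lia.
have := lo i a; have := lo (i + len) (a + B + 2).
have := lo (P + j) b.-1; have := lo (P + j + len) (b + B).
rewrite -eqA -eqB -/a -/b /G.
have := iter_sigma_pos_balance N a (a + B + 2) b.-1 (b + B).
lia.
Qed.

Lemma occ_factor_trib_gap2 k : 1 < k -> exists i j n,
  1 < occ (factor trib i n) (factor trib 0 k) /\ occ (factor trib j n) (factor trib 0 k) = 0.
Proof.
move=> k_gt1; have [N [s [_ occ_0]]] := agree_occurrences 0 k.
have iter0 N' : iter N' sigma_pos 0 = 0 by elim: N' => //= n' ->.
have s0 : s = 0 by have [|m] := (occ_0 0).1 => //; lia.
(* For [N] equal to 0 or 1 the two distances differ only by [N]. But then the prefix 01 would recur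
   at position 1 or 2, where 10 and 02 are read. *)
have N_ge2 : 1 < N.
  have occ_at m : agree (iter N sigma_pos m) 0 k by apply/occ_0; exists m; rewrite s0 addn0.
  case: N occ_at {occ_0} => [|[|//]] occ_at.
    by have := occ_at 1 0 (ltnW k_gt1).
  by have := occ_at 1 1 k_gt1.
have gap : iter N sigma_pos 4 + 2 <= iter N sigma_pos 3 + iter N sigma_pos 1.
  have gap3 M : [/\ iter M.+2 sigma_pos 4 + 2 <= iter M.+2 sigma_pos 3 + iter M.+2 sigma_pos 1,
    iter M.+3 sigma_pos 4 + 2 <= iter M.+3 sigma_pos 3 + iter M.+3 sigma_pos 1 &
    iter M.+4 sigma_pos 4 + 2 <= iter M.+4 sigma_pos 3 + iter M.+4 sigma_pos 1].
    elim: M => [//|M [? ? ?]]; split=> //.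
    by rewrite !(iter_sigma_pos_rec M.+2); lia.
  by case: N N_ge2 {occ_0} => [|[|N]] // _; have [] := gap3 N.
pose G m := iter N sigma_pos m + 0.
pose Q p := factor trib p k == factor trib 0 k.
have QP p : Q p <-> exists m, p = G m.
  by rewrite /G -s0 -occ_0; split=> /eq_factor_agree.
have lo := count_iota_increasing Q G (iter_sigma_pos_mono N 0) QP.
pose L := (iter N sigma_pos 4 - iter N sigma_pos 3).
have lt34 := @leq_iter_sigma_pos N 3 4 isT.
(* Since [trib 3] is 2, [L] is the shorter distance. The second window admits the starting positions
   1 to [L + 1], strictly between the occurrences at 0 and [iter N sigma_pos 1]; this uses the gap
   of 2. *)
exists (iter N sigma_pos 3), 1, (L + k); rewrite !occ_factor ?size_mkseq ?leq_addl // addnK.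
rewrite -/Q; split.
  have := count_iota_sub Q (iter N sigma_pos 3) L.+1.
  have := lo (iter N sigma_pos 3) 3; have := lo (iter N sigma_pos 3 + L.+1) 4.
  by rewrite /G /L; lia.
have := count_iota_sub Q 1 L.+1.
have := lo 1 0; have := lo (1 + L.+1) 1.
by rewrite /G iter0 /L; lia.
Qed.

Theorem theorem22 (k : nat) : 1 <= k ->
  balanced trib k 2 /\ (forall C : nat, 1 <= C -> balanced trib k C -> 2 <= C).
Proof.
move=> k_gt0; split=> [i j n w sz_w _|C _ balC].
  by split; apply: occ_factor_trib_le2; rewrite sz_w.
suff [i [j [n [w [sz_w w_alph gt1 eq0]]]]] : exists i j n w, [/\ size w = k, all in_alph w,
    1 < occ (factor trib i n) w & occ (factor trib j n) w = 0].
  have [le_C _] := balC i j n w sz_w w_alph.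
  by rewrite eq0 subn0 in le_C; apply: leq_trans gt1 le_C.
have [k_gt1|k_le1] := ltnP 1 k.
  have [i [j [n [gt1 eq0]]]] := occ_factor_trib_gap2 k k_gt1.
  exists i, j, n, (factor trib 0 k); split=> //; first exact: size_mkseq.
  by apply/allP => a /mapP[m _ ->]; apply: trib_lt3.
have -> : k = 1 by lia.
(* The prefix 0 has distances 2 and 1, too close together, so the letter 1 is used: the factors 101
   and 020 start at positions 12 and 2. *)
by exists 12, 2, 3, [:: 1]; split=> //; vm_compute.
Qed.
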